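(* For every integer $n\geq 0$, the total of $\mathrm{sumelements}(\pi)$ over all set partitions $\pi$ of $[n]$ is $$\sum_{\pi\in P_n}\mathrm{sumelements}(\pi)=\frac{1}{3}B_{n+3}-\frac{1}{4}B_{n+2}-\left(\frac{1}{2}n+\frac{13}{12}\right)B_{n+1}-\left(\frac{1}{12}+\frac{1}{2}n\right)B_n,$$ where $B_m$ denotes the $m$-th Bell number.
   Context: A set partition of $[n]$ with exactly $k$ blocks is a collection $\{B_1,\dots,B_k\}$ of nonempty pairwise disjoint subsets with union $[n]$, indexed so that $\min B_1<\cdots<\min B_k$; $P_n$ is the set of all set partitions of $[n]$ (with any number of blocks). A partition is identified with its canonical sequential form $\pi=\pi_1\cdots\pi_n$, where $i\in B_{\pi_i}$. An entry $\pi_i$ is a record if $\pi_i>\pi_j$ for all $j<i$; the records are the first occurrences of $1,\dots,k$. For $a\in[k]$, $\mathrm{sumelements}_a(\pi)$ is the sum of all entries of $\pi$ at positions strictly before the record $a$, and $\mathrm{sumelements}(\pi)=\sum_{a=1}^{k}\mathrm{sumelements}_a(\pi)$. For example, $\mathrm{sumelements}(121132)=1+(1+2+1+1)=6$. *)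

(* Defs.v *)
From mathcomp Require Import all_boot all_order all_algebra.
Set Implicit Arguments.
Unset Strict Implicit.
Unset Printing Implicit Defensive.

(* The ground set [n] = {1, ..., n} is represented by 'I_n = {0, ..., n-1},
   and positions in words are counted from 0; the letters of the canonical
   form keep their values 1, ..., k. *)

Definition set_partitions (n : nat) : {set {set {set 'I_n}}} :=
  [set P : {set {set 'I_n}} | partition P [set: 'I_n]].

Definition bell (n : nat) : nat := #|set_partitions n|.

(* The default value n is only reached on the empty set, never on a block. *)
Definition set_min (n : nat) (B : {set 'I_n}) : nat :=
  \big[minn/n]_(i in B) (i : nat).

Definition blocks (n : nat) (P : {set {set 'I_n}}) : seq {set 'I_n} :=
  sort (fun B C => set_min B <= set_min C) (enum P).

(* Since index counts from 0, B_1 is the first item of blocks P. *)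
Definition canonical_form (n : nat) (P : {set {set 'I_n}}) : seq nat :=
  [seq (index (pblock P i) (blocks P)).+1 | i <- enum 'I_n].

Definition is_record (w : seq nat) (p : nat) : bool :=
  [forall q : 'I_p, nth 0 w q < nth 0 w p].

(* Two distinct records have distinct values, so at most one position p
   contributes to the outer sum: that of the record a. *)
Definition sumelements_at (a : nat) (w : seq nat) : nat :=
  \sum_(p < size w | is_record w p && (nth 0 w p == a))
    \sum_(q < p) nth 0 w q.

Definition sumelements (n : nat) (P : {set {set 'I_n}}) : nat :=
  \sum_(1 <= a < #|P|.+1) sumelements_at a (canonical_form P).

(* Main.v *)
(** Canonical forms of set partitions are exactly the restricted growth words:
    a canonical form is a restricted growth word, and a restricted growth word
    is determined by which of its letters are equal.  Appending a letter to a
    word with maximum [k] turns [sum_w f (max w)] into [sum_w (L f) (max w)]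
    with [(L f) k = k * f k + f k.+1] ([append_op] below).  The sums of [sumn w * f (max w)] and of
    [record_sum w * f (max w)] are again of the form [sum_w g (max w)], with
    [g] obtained from [f] by explicit operators; for [f = 1] the latter is a
    combination of [1], [L 1], [L (L 1)] and [L (L (L 1))], which stand for
    [B_n], ..., [B_(n+3)]. *)

Require Import Defs.
From mathcomp Require Import all_boot all_order all_algebra.
From mathcomp Require Import zify ring.
Import GRing.Theory.
Local Open Scope ring_scope.

(** * Restricted growth words *)

Definition word_max (w : seq nat) : nat := (\max_(x <- w) x)%N.

(** Indexed by the position of the record instead of its value, so that appending a letter adds at
    most one term. *)
Definition record_sum (w : seq nat) : nat :=
  (\sum_(p < size w | is_record w p) \sum_(q < p) nth 0 w q)%N.

Fixpoint growth_words (n : nat) : seq (seq nat) :=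
  if n is m.+1 then
    [seq rcons w c | w <- growth_words m, c <- iota 1 (word_max w).+1]
  else [:: [::]].

Section Words.
Local Open Scope nat_scope.
Implicit Types (w : seq nat) (n c v : nat).

Lemma word_max_rcons w c : word_max (rcons w c) = maxn (word_max w) c.
Proof. by rewrite /word_max -cats1 big_cat big_seq1. Qed.

Lemma leq_word_max w c : c \in w -> c <= word_max w.
Proof. by move=> cw; rewrite /word_max (big_rem c) //= leq_maxl. Qed.

Lemma nth_leq_word_max w q : nth 0 w q <= word_max w.
Proof.
case: (ltnP q (size w)) => [/(mem_nth 0)/leq_word_max //|le_wq].
by rewrite nth_default.
Qed.

(** Positivity of [c] covers the empty word, whose maximum is 0 while its first appended letter is
    vacuously a record. *)
Lemma is_record_last w c :
  0 < c -> is_record (rcons w c) (size w) = (word_max w < c).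
Proof.
move=> c_gt0; rewrite /is_record nth_rcons ltnn eqxx.
apply/forallP/idP => [rec|lt_c q]; last first.
  by rewrite nth_rcons ltn_ord; apply: leq_ltn_trans (nth_leq_word_max _ _) lt_c.
rewrite /word_max big_seq; elim/big_ind: _ => // [x y ltx lty|x].
  by rewrite gtn_max ltx.
move=> /(nthP 0)[q ltq <-]; have := rec (Ordinal ltq).
by rewrite /= nth_rcons ltq.
Qed.

Lemma is_record_rcons w c p :
  p < size w -> is_record (rcons w c) p = is_record w p.
Proof.
move=> ltp; apply: eq_forallb => q.
by rewrite !nth_rcons ltp (ltn_trans (ltn_ord q) ltp).
Qed.

Lemma record_sum_rcons w c : 0 < c ->
  record_sum (rcons w c) = record_sum w + (if word_max w < c then sumn w else 0).
Proof.
move=> c_gt0; rewrite /record_sum size_rcons big_mkcond big_ord_recr /=.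
rewrite is_record_last //; congr (_ + _).
  rewrite [RHS]big_mkcond; apply: eq_bigr => p _.
  rewrite is_record_rcons //; case: ifP => // _; apply: eq_bigr => q _.
  by rewrite nth_rcons (ltn_trans (ltn_ord q)).
case: ifP => // _; rewrite sumnE (big_nth 0) big_mkord; apply: eq_bigr => q _.
by rewrite nth_rcons ltn_ord.
Qed.

Lemma mem_growth_words_rcons n w c :
  (rcons w c \in growth_words n.+1) =
  (w \in growth_words n) && (0 < c <= (word_max w).+1).
Proof.
apply/allpairsPdep/andP => [[w' [c' [w'n c'w']]] /rcons_inj[-> ->]|[wn cw]].
  by rewrite w'n; move: c'w'; rewrite mem_iota; lia.
by exists w, c; rewrite mem_iota; split=> //; lia.
Qed.

Lemma size_growth_words n w : w \in growth_words n -> size w = n.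
Proof.
elim: n w => [|n IHn] w; first by rewrite inE => /eqP->.
by case/allpairsPdep=> w' [c [/IHn <- _ ->]]; rewrite size_rcons.
Qed.

Lemma uniq_growth_words n : uniq (growth_words n).
Proof.
elim: n => // n IHn.
apply: (@allpairs_uniq_dep _ _ _ (fun w c => rcons w c)) => // [w _|].
  exact: iota_uniq.
by move=> [w c] [w' c'] _ _ /= /rcons_inj[-> ->].
Qed.

(** Bounding each letter by its prefix gives a criterion without recursion, which can be checked on
    canonical forms position by position. *)
Lemma growth_wordsP n w : reflect
  (size w = n /\
   forall p, p < n -> 0 < nth 0 w p <= (word_max (take p w)).+1)
  (w \in growth_words n).
Proof.
elim: n w => [|n IHn] w.
  rewrite inE; apply: (iffP eqP) => [->|[/size0nil //]].
  by split.
apply: (iffP idP) => [|[sz_w bnd]].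
  case/lastP: w => [/size_growth_words //|w c].
  rewrite mem_growth_words_rcons => /andP[/IHn[sz_w bnd] cw].
  rewrite size_rcons sz_w; split=> // p; rewrite ltnS leq_eqVlt => /predU1P[->|ltp].
    by rewrite nth_rcons sz_w ltnn eqxx -cats1 -sz_w take_size_cat.
  by rewrite nth_rcons sz_w ltp -cats1 takel_cat ?sz_w ?(ltnW ltp) // bnd.
case/lastP: w sz_w bnd => // w c; rewrite size_rcons => -[sz_w] bnd.
rewrite mem_growth_words_rcons; apply/andP; split; last first.
  have := bnd n (ltnSn n).
  by rewrite nth_rcons sz_w ltnn eqxx -cats1 -sz_w take_size_cat.
apply/IHn; split=> // p ltp; have := bnd p (ltnW ltp).
by rewrite nth_rcons sz_w ltp -cats1 takel_cat // sz_w ltnW.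
Qed.

(** No value is skipped, since an appended letter raises the maximum by at most one. *)
Lemma mem_growth_word n w v :
  w \in growth_words n -> (v \in w) = (0 < v <= word_max w).
Proof.
elim: n w => [|n IHn] w.
  by rewrite inE => /eqP->; rewrite /word_max big_nil in_nil; lia.
case/lastP: w => [/size_growth_words //|w c].
rewrite mem_growth_words_rcons => /andP[/IHn mem_w cw].
by rewrite mem_rcons inE mem_w word_max_rcons; lia.
Qed.

Lemma growth_word_inj n w w' :
  w \in growth_words n -> w' \in growth_words n ->
  (forall p q, p < n -> q < n ->
     (nth 0 w p == nth 0 w q) = (nth 0 w' p == nth 0 w' q)) ->
  w = w'.
Proof.
elim: n w w' => [|n IHn] w w'; first by rewrite !inE => /eqP-> /eqP->.
case/lastP: w => [/size_growth_words //|w c].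
case/lastP: w' => [_ /size_growth_words //|w' c'].
rewrite !mem_growth_words_rcons => /andP[gw cw] /andP[gw' cw'] eqk.
have sw := size_growth_words _ _ gw; have sw' := size_growth_words _ _ gw'.
have ww' : w = w'.
  apply: IHn => // p q ltp ltq; have := eqk p q (ltnW ltp) (ltnW ltq).
  by rewrite !nth_rcons sw sw' ltp ltq.
move: cw' sw' eqk; rewrite -{w' gw'}ww' => cw' _ eqk; congr rcons.
have eqc q : q < n -> (c == nth 0 w q) = (c' == nth 0 w q).
  move=> ltq; have := eqk n q (ltnSn n) (ltnW ltq).
  by rewrite !nth_rcons sw ltnn eqxx ltq.
have old d : 0 < d <= word_max w -> (c == d) = (c' == d).
  rewrite -(mem_growth_word _ _ _ gw) => /(nthP 0)[q]; rewrite sw => ltq <-.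
  exact: eqc.
(* A last letter that is at most the maximum already occurs in [w], so the pattern of equalities
   identifies it; if both last letters are new, both are the maximum plus one. *)
have [le_c|lt_c] := leqP c (word_max w).
  by have := old c; rewrite eqxx => /(_ ltac:(lia))/esym/eqP.
have [le_c'|lt_c'] := leqP c' (word_max w); last by lia.
by have := old c'; rewrite eqxx => /(_ ltac:(lia))/eqP.
Qed.

End Words.

(** * Canonical forms as restricted growth words *)

Section CanonicalForm.
Local Open Scope nat_scope.
Variable n : nat.
Implicit Types (B C : {set 'I_n}) (P : {set {set 'I_n}}).

Lemma set_min_leq B (i : 'I_n) : i \in B -> set_min B <= i.
Proof.
rewrite /set_min => iB; have := mem_index_enum i.
elim: (index_enum _) => // j r IHr; rewrite inE big_cons => /predU1P[<-|/IHr le].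
  by rewrite iB geq_minl.
by case: ifP => // _; apply: leq_trans (geq_minr _ _) le.
Qed.

Lemma set_min_mem B : B != set0 -> exists2 i, i \in B & set_min B = i :> nat.
Proof.
case/set0Pn=> i0 i0B.
have : set_min B = n \/ exists2 i, i \in B & set_min B = i :> nat.
  rewrite /set_min; elim/big_rec: _ => [|i x iB IHx]; first by left.
  have [_|_] := leqP i x; last by [].
  by right; exists i.
case=> // eq_n; have := set_min_leq B i0 i0B.
by rewrite eq_n leqNgt ltn_ord.
Qed.

Variable P : {set {set 'I_n}}.
Hypothesis partP : P \in set_partitions n.

Let partnP : partition P [set: 'I_n]. Proof. by move: partP; rewrite inE. Qed.

Lemma mem_blocks B : (B \in blocks P) = (B \in P).
Proof. by rewrite mem_sort mem_enum. Qed.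

Lemma pblock_in_blocks (i : 'I_n) : pblock P i \in blocks P.
Proof. by rewrite mem_blocks pblock_mem // (cover_partition partnP) inE. Qed.

Lemma size_canonical_form : size (canonical_form P) = n.
Proof. by rewrite size_map size_enum_ord. Qed.

Lemma nth_canonical_form (i : 'I_n) :
  nth 0 (canonical_form P) i = (index (pblock P i) (blocks P)).+1.
Proof. by rewrite (nth_map i) ?size_enum_ord // nth_ord_enum. Qed.

Lemma canonical_form_eq (i j : 'I_n) :
  (nth 0 (canonical_form P) i == nth 0 (canonical_form P) j) =
  (pblock P i == pblock P j).
Proof.
rewrite !nth_canonical_form eqSS; apply/eqP/eqP => [eq_ij|-> //].
by rewrite -(nth_index set0 (pblock_in_blocks i)) eq_ij nth_index ?pblock_in_blocks.
Qed.

(** If the block of [i] is not the first, the block listed just before it has a smaller minimum [j];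
    the letter at [j] precedes position [i] and is one less than the letter there. *)
Lemma canonical_form_growth : canonical_form P \in growth_words n.
Proof.
have [_ tiP P0] := and3P partnP.
apply/growth_wordsP; split=> [|p ltp]; first exact: size_canonical_form.
pose i := Ordinal ltp; rewrite (nth_canonical_form i) /= ltnS.
case def_v: (index _ _) => [//|v].
have lt_v : v.+1 < size (blocks P) by rewrite -def_v index_mem pblock_in_blocks.
pose C := nth set0 (blocks P) v.
have CP : C \in P by rewrite -mem_blocks mem_nth // ltnW.
have idxC : index C (blocks P) = v.
  by rewrite index_uniq ?sort_uniq ?enum_uniq // ltnW.
have [j jC minj] : exists2 j, j \in C & set_min C = j :> nat.
  by apply: set_min_mem; apply: contraNneq P0 => <-.
have pbj : pblock P j = C by apply: def_pblock.
have le_min : set_min C <= set_min (pblock P i).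
  have srt : sorted (fun B C => set_min B <= set_min C) (blocks P).
    by apply: sort_sorted => B D; apply: leq_total.
  have tr : transitive (fun B C => set_min B <= set_min C).
    by move=> B D E; apply: leq_trans.
  have rf : reflexive (fun B C => set_min B <= set_min C) by move=> B; apply: leqnn.
  have := sorted_leq_nth tr rf set0 srt.
  move=> /(_ v v.+1); rewrite !inE lt_v (ltnW lt_v) leqnSn => /(_ isT isT isT).
  by rewrite -{1}def_v nth_index // pblock_in_blocks.
have le_ji : j <= i.
  rewrite -minj; apply: leq_trans le_min _; apply: set_min_leq.
  by rewrite mem_pblock (cover_partition partnP) inE.
have lt_ji : j < i.
  rewrite ltn_neqAle le_ji andbT; apply: contraPneq def_v => /val_inj eq_ji.
  by rewrite -eq_ji pbj idxC; lia.
have wj : nth 0 (canonical_form P) j = v.+1.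
  by rewrite nth_canonical_form pbj idxC.
rewrite -wj -(nth_take (n0 := p)) //; exact: nth_leq_word_max.
Qed.

(** After exchanging the sums, each record position meets exactly one value [a], namely its own
    letter, which lies between 1 and the number of blocks. *)
Lemma sumelements_record_sum : sumelements P = record_sum (canonical_form P).
Proof.
rewrite /sumelements /sumelements_at /record_sum.
under eq_bigr do rewrite big_mkcondr.
rewrite exchange_big; apply: eq_bigr => p _ /=.
have ltpn : p < n by rewrite -{2}size_canonical_form.
have eqp : nth 0 (canonical_form P) p = (index (pblock P (Ordinal ltpn)) (blocks P)).+1.
  exact: (nth_canonical_form (Ordinal ltpn)).
have szP : size (blocks P) = #|P| by rewrite size_sort -cardE.
under eq_bigr do rewrite eq_sym.
rewrite -big_mkcond /= big_nat1_eq eqp !ltnS -szP index_mem pblock_in_blocks //.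
Qed.

End CanonicalForm.

(** * Bijection between set partitions and growth words *)

Section Bijection.
Local Open Scope nat_scope.
Variable n : nat.

Lemma canonical_form_inj :
  {in set_partitions n &, injective (@canonical_form n)}.
Proof.
move=> P Q partP partQ eqPQ.
have := partP; have := partQ; rewrite !inE => partnQ partnP.
(* Each partition is recovered from the relation of lying in the same block, which is equality of
   letters. *)
rewrite -(preim_partition_pblock partnP) -(preim_partition_pblock partnQ).
apply: eq_imset => i; apply/setP => j; rewrite !inE.
by rewrite -!canonical_form_eq // eqPQ.
Qed.

Lemma growth_word_canonical (w : seq nat) : w \in growth_words n ->
  exists2 P, P \in set_partitions n & canonical_form P = w.
Proof.
move=> gw; pose f (i : 'I_n) := nth 0 w i.
(* Positions are grouped by equal letters; the canonical form of this partition then has the same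
   equalities as [w]. *)
pose P := preim_partition f [set: 'I_n].
have partP : P \in set_partitions n by rewrite inE preim_partitionP.
exists P => //; apply: (growth_word_inj n) => // [|p q ltp ltq].
  exact: canonical_form_growth.
have := canonical_form_eq _ _ partP (Ordinal ltp) (Ordinal ltq) => /= ->.
have := partP; rewrite inE => /and3P[/eqP cP tiP _].
rewrite eq_pblock ?cP ?inE //.
rewrite (pblock_equivalence_partition _ _ _) ?inE // => i j k _ _ _.
by split => // /eqP ->.
Qed.

Lemma sum_set_partitions (V : nmodType) (F : seq nat -> V) :
  (\sum_(P in set_partitions n) F (canonical_form P) =
   \sum_(w <- growth_words n) F w)%R.
Proof.
rewrite -big_enum /= -(big_map (@canonical_form n) predT) /=.
apply: perm_big; apply: uniq_perm; last 1 first.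
- move=> w; apply/mapP/idP => [[P]|/growth_word_canonical[P partP <-]].
    by rewrite mem_enum => partP ->; apply: canonical_form_growth.
  by exists P; rewrite ?mem_enum.
- rewrite map_inj_in_uniq ?enum_uniq // => P Q; rewrite !mem_enum.
  exact: canonical_form_inj.
exact: uniq_growth_words.
Qed.

End Bijection.

(** * Totals of functions of the maximum *)

Definition max_total (n : nat) (f : nat -> rat) : rat :=
  \sum_(w <- growth_words n) f (word_max w).

Definition append_op (f : nat -> rat) (k : nat) : rat := k%:R * f k + f k.+1.

(* In the generating function [A_k = \prod_(1 <= i <= k) x / (1 - i x)] of the
   words with maximum [k], put [P_i = i x / (1 - i x)].  Letter sums and record
   sums multiply [A_k] by combinations of [P_i], [i P_i] and [i^2 P_i]; since
   [i P_i = P_i / x - i] and [\sum_i P_i = x A_k' / A_k - k], only [A_k], [x A_k']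
   and their quotients by [x] and [x^2] remain.  Dividing by [x] raises the
   length by one, which is [append_op] on the test function [f]. *)
Definition letters_op (n : nat) (f : nat -> rat) (k : nat) : rat :=
  (k%:R * (k%:R + 1) / 4 + (n%:R - k%:R) / 2) * f k
  + append_op (fun j => (n%:R + 1 - j%:R) / 2 * f j) k.

Definition records_op (n : nat) (f : nat -> rat) (k : nat) : rat :=
  (k%:R ^+ 2 * (k%:R + 1) / 2 - k%:R * (k%:R + 1) * (2 * k%:R + 1) / 12
   + k%:R * (n%:R - k%:R) / 2 - (k%:R - 1) * k%:R * (k%:R + 1) / 4) * f k
  + append_op (fun j => ((j%:R - 1) * (n%:R + 1 - j%:R) / 2
                         + j%:R * (j%:R + 1) / 4) * f j) k
  - append_op (append_op (fun j => (n%:R + 2 - j%:R) / 2 * f j)) k.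

Lemma growth_words_S (n : nat) (F : seq nat -> rat) :
  \sum_(w <- growth_words n.+1) F w =
  \sum_(w <- growth_words n)
    (\sum_(c <- iota 1 (word_max w)) F (rcons w c) + F (rcons w (word_max w).+1)).
Proof.
rewrite (big_allpairs_dep (h := fun w c => rcons w c)); apply: eq_bigr => w _.
by rewrite -{1}[(word_max w).+1]addn1 iotaD big_cat big_seq1 add1n.
Qed.

Lemma sum_old_letters (w : seq nat) (F : seq nat -> rat) (G : nat -> rat) :
  (forall c, (0 < c <= word_max w)%N -> F (rcons w c) = G c) ->
  \sum_(c <- iota 1 (word_max w)) F (rcons w c) = \sum_(c <- iota 1 (word_max w)) G c.
Proof. by move=> FG; apply: eq_big_seq => c; rewrite mem_iota => ?; apply: FG; lia. Qed.

Lemma sum_iota_const (m : nat) (x : rat) : \sum_(c <- iota 1 m) x = m%:R * x.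
Proof. by rewrite big_const_seq count_predT size_iota iter_addr_0 mulr_natl. Qed.

Lemma sum_iota_id (m : nat) : \sum_(c <- iota 1 m) c%:R = m%:R * (m%:R + 1) / 2 :> rat.
Proof.
elim: m => [|m IHm]; first by rewrite big_nil; ring.
by rewrite -[m.+1]addn1 iotaD big_cat big_seq1 /= IHm add1n; field.
Qed.

Lemma max_totalS (n : nat) (f : nat -> rat) :
  max_total n.+1 f = max_total n (append_op f).
Proof.
rewrite /max_total growth_words_S; apply: eq_bigr => w _.
rewrite (sum_old_letters w (fun w => f (word_max w)) (fun=> f (word_max w))).
  by rewrite sum_iota_const word_max_rcons /append_op (maxn_idPr _).
by move=> c /andP[_ le_c]; rewrite word_max_rcons (maxn_idPl _).
Qed.

Lemma eq_max_total (n : nat) (f g : nat -> rat) :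
  f =1 g -> max_total n f = max_total n g.
Proof. by move=> fg; apply: eq_bigr => w _; apply: fg. Qed.

Lemma max_totalD (n : nat) (f g : nat -> rat) :
  max_total n f + max_total n g = max_total n (fun k => f k + g k).
Proof. by rewrite -big_split. Qed.

Lemma max_totalZ (n : nat) (a : rat) (f : nat -> rat) :
  a * max_total n f = max_total n (fun k => a * f k).
Proof. by rewrite /max_total mulr_sumr. Qed.

(** Induction on [n] for all [f] at once, as the step applies the hypothesis to [append_op f]. What
    remains is the recursion satisfied by [letters_op], a pointwise identity in [k]. *)
Lemma letters_totalE (n : nat) (f : nat -> rat) :
  \sum_(w <- growth_words n) (sumn w)%:R * f (word_max w) = max_total n (letters_op n f).
Proof.
elim: n f => [|n IHn] f.
  by rewrite /max_total !big_seq1 /= /letters_op /append_op /word_max big_nil; field.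
rewrite growth_words_S max_totalS.
(* The last summands come from the appended letter: the old letters 1 to the maximum share the value
   of [f], and the new one shifts its argument. *)
rewrite (eq_bigr (fun w => (sumn w)%:R * append_op f (word_max w)
    + ((word_max w)%:R * ((word_max w)%:R + 1) / 2 * f (word_max w)
       + (word_max w).+1%:R * f (word_max w).+1))) => [|w _].
  rewrite big_split IHn [X in _ + X = _](_ : _ = max_total n (fun k =>
    k%:R * (k%:R + 1) / 2 * f k + k.+1%:R * f k.+1)) // max_totalD.
  by apply: eq_max_total => k; rewrite /letters_op /append_op; field.
rewrite (sum_old_letters w (fun w => (sumn w)%:R * f (word_max w))
  (fun c => (sumn w)%:R * f (word_max w) + c%:R * f (word_max w))).
  rewrite big_split /= sum_iota_const -mulr_suml sum_iota_id.
  by rewrite word_max_rcons (maxn_idPr _) // sumn_rcons natrD /append_op; field.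
move=> c /andP[_ le_c]; rewrite word_max_rcons (maxn_idPl _) //.
by rewrite sumn_rcons natrD mulrDl.
Qed.

Lemma records_totalE (n : nat) (f : nat -> rat) :
  \sum_(w <- growth_words n) (record_sum w)%:R * f (word_max w) =
  max_total n (records_op n f).
Proof.
elim: n f => [|n IHn] f.
  (* For the empty word, the two operator terms each contribute [f 1 / 2] and cancel. *)
  rewrite /max_total !big_seq1 /= /records_op /append_op /word_max big_nil.
  by rewrite /record_sum big_ord0; field.
rewrite growth_words_S max_totalS.
(* Only the new letter is a record, and it adds [sumn w]; hence the letter sum enters with [f]
   shifted by one. *)
rewrite (eq_bigr (fun w => (record_sum w)%:R * append_op f (word_max w)
    + (sumn w)%:R * f (word_max w).+1)) => [|w _].
  rewrite big_split /= IHn (letters_totalE n (fun k => f k.+1)) max_totalD.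
  by apply: eq_max_total => k; rewrite /records_op /letters_op /append_op; field.
rewrite (sum_old_letters w (fun w => (record_sum w)%:R * f (word_max w))
  (fun=> (record_sum w)%:R * f (word_max w))).
  rewrite sum_iota_const word_max_rcons (maxn_idPr _) // record_sum_rcons //.
  by rewrite ltnSn natrD /append_op; ring.
move=> c /andP[c_gt0 le_c]; rewrite word_max_rcons (maxn_idPl _) //.
by rewrite record_sum_rcons // ltnNge le_c addn0.
Qed.

(** * Bell numbers and the final formula *)

Lemma bell_max_total (n : nat) : (bell n)%:R = max_total n (fun=> 1).
Proof. by rewrite /bell -sum1_card natr_sum (sum_set_partitions n _ (fun=> 1)). Qed.

Theorem theorem4 (n : nat) :
  (\sum_(P in set_partitions n) sumelements P)%N%:R
  = 1 / 3 * (bell (n + 3))%:R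
    - 1 / 4 * (bell (n + 2))%:R
    - (1 / 2 * n%:R + 13 / 12) * (bell (n + 1))%:R
    - (1 / 12 + 1 / 2 * n%:R) * (bell n)%:R :> rat.
Proof.
rewrite natr_sum (eq_bigr (fun P => (record_sum (canonical_form P))%:R * 1)); last first.
  by move=> P partP; rewrite mulr1 sumelements_record_sum.
rewrite (sum_set_partitions n _ (fun w => (record_sum w)%:R * 1)).
(* All Bell numbers are brought down to words of length [n], with [append_op] iterated up to three
   times on 1; the formula then holds for each maximum [k] separately. *)
rewrite (records_totalE n (fun=> 1)) !bell_max_total addn3 addn2 addn1 !max_totalS.
rewrite -!mulNr !max_totalZ !max_totalD; apply: eq_max_total => k.
by rewrite /records_op /append_op; field.
Qed.
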